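(* For $m_1=2$ and $m_2\ge 2$, the puzzle graph $puz[P(h;m_1,m_2)]$ of the $m_1\times m_2$ parallelogram board with $h$ holes has $(m_1m_2-h)!$ connected components containing non-isolated configurations.
   Context: Hexagons of the regular hexagonal tessellation of the plane are identified with points of $\mathbb{Z}^2$; two hexagons are adjacent (share an edge) iff their difference is one of $\pm(1,0),\pm(0,1),\pm(1,1)$. A board $B$ is a finite set of hexagons (positions). The $m_1\times m_2$ parallelogram board ($m_1$ columns, $m_2$ rows) is $P(m_1,m_2)=\{0,\dots,m_1-1\}\times\{0,\dots,m_2-1\}$. $B(h)$ denotes the board $B$ with $h$ holes, that is, with $h$ unoccupied positions: a configuration of $B(h)$ is a placement of $t=|B|-h$ tiles with distinct labels $1,\dots,t$ on distinct positions of $B$; the $h$ unoccupied positions are the holes (unlabeled; adjacent holes are counted separately). A slide moves a tile from its position $p$ to a hole $q$ adjacent to $p$, and is permitted iff there is another hole $r$ that is adjacent to both $p$ and $q$. The puzzle graph $puz[B(h)]$ has the configurations of $B(h)$ as vertices, with an edge between two configurations whenever one can be obtained from the other by one slide. A configuration is isolated if no slides are possible from it, and non-isolated if there is at least one tile that can slide. $P(h;m_1,m_2)$ is the board $P(m_1,m_2)$ with $h$ holes.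
   Formalization: The number of holes is restricted to 2 ≤ h < m1·m2: with h = 0, 1 or m1·m2 no slide is possible, so there are 0 components containing non-isolated configurations while (m1·m2−h)! ≥ 1, and for h > m1·m2 the puzzle is undefined. *)

(* Defs.v *)
From HB Require Import structures.
From mathcomp Require Import all_boot all_order all_algebra.
From mathcomp Require Import finmap.

Set Implicit Arguments.
Unset Strict Implicit.
Unset Printing Implicit Defensive.

Import GRing.Theory.

Local Open Scope ring_scope.
Local Open Scope fset_scope.

Definition hexagon := (int * int)%type.

Definition hex_adj (p q : hexagon) : bool :=
  (q - p) \in [:: (1, 0); (- 1, 0); (0, 1); (0, - 1); (1, 1); (- 1, - 1)].

(* m1 columns (first coordinate) and m2 rows (second coordinate). *)
Definition parallelogram (m1 m2 : nat) : {fset hexagon} :=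
  [fset (i%:Z, j%:Z) | i in iota 0 m1, j in iota 0 m2].

Section Puzzle.
Variables (B : {fset hexagon}) (h : nat).

(* A configuration sends each label to the position of the tile bearing it.
   The labels 1, ..., t of the t = #|B| - h tiles are encoded as 0, ..., t - 1.
   The subtraction is truncated: this is meaningful only for h <= #|` B|. *)
Definition config : finType :=
  {c : {ffun 'I_(#|` B| - h) -> B} | injectiveb c}.

Definition hole (c : config) (q : B) : bool := q \notin codom (val c).

(* The hole r below is distinct from the hole q, hex_adj being irreflexive. *)
Definition slide_of (i : 'I_(#|` B| - h)) (c c' : config) : bool :=
  let p := val c i in
  let q := val c' i in
  [&& [forall j, (j != i) ==> (val c' j == val c j)],
      hole c q, hex_adj (val p) (val q) &
      [exists r : B, [&& hole c r, hex_adj (val p) (val r)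
                                 & hex_adj (val q) (val r)]]].

Definition slide (c c' : config) : bool := [exists i, slide_of i c c'].

Definition isolated (c : config) : bool := ~~ [exists c', slide c c'].

Definition puz : rel config := [rel c c' | slide c c' || slide c' c].

End Puzzle.

Definition components (T : finType) (e : rel T) : {set {set T}} :=
  equivalence_partition (connect e) [set: T].

(* Main.v *)
Require Import Defs.
From mathcomp Require Import all_boot all_order all_algebra.
From mathcomp Require Import finmap zify.

(** A board with two columns is a triangulated strip: listing its hexagons in
    zigzag order, hexagon (i, j) at index 2 j + 1 - i, makes two hexagons
    adjacent exactly when their indices differ by 1 or 2. A configuration then
    becomes a word of length n over holes ([None]) and labels ([Some i]), and a
    slide rearranges a window of three consecutive letters made of two holes
    and one tile.

    Such a slide carries a tile over nothing but holes, so the labels read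
    along the strip never change ([slide_order]). Conversely, a configuration
    that is not isolated contains a window with two holes ([loose_word]), which
    may be arranged as a pair of adjacent holes. This pair jumps over any
    neighbouring tile, hence travels along the whole word, and it drags with it
    every single hole it meets; so all the holes can be gathered at the start
    of the strip, the tiles following in their invariant order
    ([reach_sorted]). Two configurations that are not isolated are therefore
    connected if and only if they have the same label order.

    Finally every one of the t! orders of the t tiles occurs: with two holes or
    more and at least one tile, the word with all the holes first is not
    isolated ([order_onto]). *)

Set Implicit Arguments.
Unset Strict Implicit.
Unset Printing Implicit Defensive.

(** * Words of holes and tiles *)

Section Words.
Variable I : eqType.
Implicit Types (w v u : seq (option I)) (i : I).

(** The equivalence generated by moving a tile by one place inside a window
    that has two holes; the third move of such a window, a jump of two places,
    is the composite of these. *)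
Inductive reach : seq (option I) -> seq (option I) -> Prop :=
| reach_left i v :
    reach [:: Some i, None, None & v] [:: None, Some i, None & v]
| reach_right i v :
    reach [:: None, Some i, None & v] [:: None, None, Some i & v]
| reach_cons x w w' : reach w w' -> reach (x :: w) (x :: w')
| reach_refl w : reach w w
| reach_sym w w' : reach w w' -> reach w' w
| reach_trans w w' w'' : reach w w' -> reach w' w'' -> reach w w''.

Lemma reach_size w w' : reach w w' -> size w = size w'.
Proof. by elim=> //= [x ? ? _ -> | ? ? ? _ -> _ ->]. Qed.

Lemma reach_labels w w' : reach w w' -> pmap id w = pmap id w'.
Proof. by elim=> //= [[x|] ? ? _ /= -> | ? ? ? _ -> _ ->]. Qed.

Lemma reach_cat u w w' : reach w w' -> reach (u ++ w) (u ++ w').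
Proof. by move=> r; elim: u => //= x u; apply: reach_cons. Qed.

(** The tile crosses the block one place at a time, assisted by the hole beyond
    its target, and for the last place by the hole that it has just passed. *)
Lemma reach_pass i a v :
  reach (Some i :: nseq a.+2 None ++ v) (nseq a.+2 None ++ Some i :: v).
Proof.
elim: a => [|a IHa] /=.
  exact: reach_trans (reach_left _ _) (reach_right _ _).
by apply: reach_trans (reach_left _ _) _; apply: reach_cons.
Qed.

Lemma reach_sorted_cons x w a l :
  reach w (nseq a.+2 None ++ map Some l) ->
  exists b l', reach (x :: w) (nseq b.+2 None ++ map Some l').
Proof.
move=> /(reach_cons x) r; case: x r => [i|] r.
  by exists a, (i :: l); apply: reach_trans r (reach_pass _ _ _).
by exists a.+1, l.
Qed.

(** A pair of holes at the front serves the whole word: it moves past the first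
    letter, sorts the rest by induction, and the holes so gathered come back
    over that letter. *)
Lemma reach_sorted_pair v :
  exists a l, reach [:: None, None & v] (nseq a.+2 None ++ map Some l).
Proof.
elim: v => [|x v [a [l r]]]; first by exists 0, [::]; apply: reach_refl.
have [b [l' r']] := reach_sorted_cons x r.
exists b, l'; apply: reach_trans r'.
case: x => [i|]; last exact: reach_refl.
exact: reach_sym (reach_pass i 0 v).
Qed.

(** Windows with a tile at one end need no case of their own, since their two
    holes are adjacent. *)
Definition loose w := exists u v,
  w = u ++ [:: None, None & v] \/
  exists i, w = u ++ [:: None, Some i, None & v].

Lemma reach_sorted w :
  loose w -> exists a, reach w (nseq a None ++ map Some (pmap id w)).
Proof.
have sortedP u v :
    exists a l, reach (u ++ [:: None, None & v]) (nseq a.+2 None ++ map Some l).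
  elim: u => [|x u [a [l]]]; [exact: reach_sorted_pair | exact: reach_sorted_cons].
suff E : loose w -> exists a l, reach w (nseq a None ++ map Some l).
  move=> /E[a [l r]]; exists a; rewrite (reach_labels r).
  by have -> : pmap id (nseq a None ++ map Some l) = l;
    [rewrite pmap_cat map_pK //; elim: a {r} | ].
case=> u [v [-> | [i ->]]].
  by have [a [l r]] := sortedP u v; exists a.+2, l.
have [a [l r]] := sortedP u (Some i :: v); exists a.+2, l.
by apply: reach_trans r; apply/reach_cat/reach_right.
Qed.

Lemma index_tile w i k :
  uniq (pmap id w) -> nth None w k = Some i -> index (Some i) w = k.
Proof.
elim: w k => [|x w IHw] [|k] //=; first by move=> _ ->; rewrite eqxx.
case: x => [j|] /=; last by move=> /IHw H /H ->.
case/andP=> jw /IHw H wk; rewrite (H _ wk); case: eqP => // -[ji]; move: jw.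
rewrite ji mem_pmap map_id -wk mem_nth //; case: ltnP => // lwk.
by rewrite nth_default in wk.
Qed.

End Words.

(** * Cardinals of images *)

(** Both images are in bijection with the image of the pairing of [f] and
    [g]. *)
Lemma eq_card_imset (T U V : finType) (f : T -> U) (g : T -> V) (A : {set T}) :
  {in A &, forall x y, (f x == f y) = (g x == g y)} -> #|f @: A| = #|g @: A|.
Proof.
move=> fg; set P := [set (f x, g x) | x in A].
have -> : f @: A = fst @: P by rewrite -imset_comp.
have -> : g @: A = snd @: P by rewrite -imset_comp.
rewrite (@card_in_imset _ _ fst) 1?(@card_in_imset _ _ snd) //.
all: move=> u v /imsetP[x Ax ->] /imsetP[y Ay ->] /= e.
  by congr pair; apply/eqP; [rewrite fg // e | rewrite e].
by congr pair; apply/eqP; [rewrite e | rewrite -fg // e].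
Qed.

(** * Puzzles on a strip *)

Definition strip_adj (k l : nat) := [&& k != l, k <= l.+2 & l <= k.+2].

(** What follows holds for any board whose adjacency graph is the square of a
    path, [idx] giving the rank of a hexagon on this path. *)
Section Strip.
Variables (B : {fset hexagon}) (h : nat) (idx : B -> nat).
Hypothesis idx_inj : injective idx.
Hypothesis idx_lt : forall p, idx p < #|` B|.
Hypothesis hex_adjE : forall p q : B,
  hex_adj (val p) (val q) = strip_adj (idx p) (idx q).
Hypothesis hh : 2 <= h < #|` B|.

Local Notation n := (#|` B|).
Local Notation I := 'I_(n - h).
Implicit Types (c : config B h).

Lemma idx_onto k : k < n -> exists p, idx p = k.
Proof.
move=> ltkn; have f_inj : injective (fun p => Ordinal (idx_lt p)).
  by move=> p q /(congr1 val) /idx_inj.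
have [|g _ gK] := inj_card_bij f_inj; first by rewrite card_ord cardfE.
by exists (g (Ordinal ltkn)); rewrite -[LHS]/(val (Ordinal (idx_lt _))) gK.
Qed.

Definition place c (i : I) : nat := idx (val c i).
Definition tile_at c k : option I := [pick i | place c i == k].
Definition word c := [seq tile_at c k | k <- iota 0 n].
Definition tile_order c : seq I := pmap id (word c).

Lemma place_inj c : injective (place c).
Proof. by move=> i j /idx_inj; apply: (injectiveP _ (valP c)). Qed.

Lemma tile_atE c k i : (tile_at c k == Some i) = (place c i == k).
Proof.
rewrite /tile_at; case: pickP => [j /eqP <-|->//].
rewrite (inj_eq (@place_inj c)) eq_sym; exact: (inj_eq Some_inj).
Qed.

Lemma size_word c : size (word c) = n.
Proof. by rewrite size_map size_iota. Qed.

Lemma nth_word c k : nth None (word c) k = tile_at c k.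
Proof.
have [ltkn|lenk] := ltnP k n.
  by rewrite (nth_map 0) ?size_iota // nth_iota.
rewrite nth_default ?size_word // /tile_at; case: pickP => // i /eqP e.
by move: (idx_lt (val c i)); rewrite -/(place c i) e ltnNge lenk.
Qed.

Lemma holeE c q : hole c q = (tile_at c (idx q) == None).
Proof.
rewrite /hole /tile_at; case: pickP => [i /eqP e|none].
  by apply/negbF/codomP; exists i; apply: idx_inj; rewrite -e.
by apply/codomP=> -[i e]; have := none i; rewrite /place -e eqxx.
Qed.

Lemma order_pmap c : tile_order c = pmap (tile_at c) (iota 0 n).
Proof. by rewrite /tile_order /word; elim: iota => //= k s ->. Qed.

Lemma mem_order c i : i \in tile_order c.
Proof.
rewrite order_pmap mem_pmap; apply/mapP; exists (place c i).
  by rewrite mem_iota idx_lt.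
by apply/esym/eqP; rewrite tile_atE.
Qed.

(** This characterises [tile_order c] among the enumerations of the labels, and
    it depends on [c] only through the relative position of its tiles. *)
Lemma sorted_order c : sorted (fun i j => place c i < place c j) (tile_order c).
Proof.
have: sorted ltn (map (place c) (tile_order c)).
  rewrite order_pmap (@pmap_filter _ _ (tile_at c) (place c)).
    by rewrite sorted_filter ?iota_ltn_sorted //; apply: ltn_trans.
  by move=> k; case E: tile_at => [i|] //=; apply/eqP; rewrite -tile_atE E.
by rewrite sorted_map.
Qed.

Lemma order_uniq c : uniq (tile_order c).
Proof.
apply: sorted_uniq (sorted_order c) => [j i k|i]; last exact: ltnn.
exact: ltn_trans.
Qed.

Lemma order_size c : size (tile_order c) == n - h.
Proof.
rewrite -(card_uniqP (order_uniq c)) -[X in _ == X]card_ord; apply/eqP/eq_card.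
by move=> i; rewrite mem_order.
Qed.

Lemma word_inj c c' : word c = word c' -> c = c'.
Proof.
move=> e; apply/val_inj/ffunP => i; apply: idx_inj; apply/eqP.
by rewrite eq_sym -[_ == _]tile_atE -nth_word -e nth_word tile_atE.
Qed.

(** By the size condition, a word without repeated labels has all of them. *)
Lemma word_onto w : size w = n -> uniq (pmap id w) -> size (pmap id w) = n - h ->
  exists c, word c = w.
Proof.
move=> size_w uniq_w size_l.
have w_all i : Some i \in w.
  have -> : (Some i \in w) = (i \in pmap id w) by rewrite mem_pmap map_id.
  have [_ ->] // : #|pmap id w| = #|I| /\ pmap id w =i predT.
  have e : #|pmap id w| = #|I| by rewrite (card_uniqP uniq_w) size_l card_ord.
  by split=> // j; apply: (subset_cardP e) ; apply/subsetP.
have [f fE] : exists f : I -> B, forall i, idx (f i) = index (Some i) w.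
  apply: (@fin_all_exists _ (fun=> B) (fun i p => idx p = index (Some i) w)) => i.
  by apply: idx_onto; move: (w_all i); rewrite -index_mem size_w.
have f_inj : injectiveb (finfun f).
  apply/injectiveP => i j; rewrite !ffunE => /(congr1 idx); rewrite !fE => e.
  by apply: Some_inj; rewrite -(nth_index None (w_all i)) e nth_index.
exists (exist _ (finfun f) f_inj : config B h).
apply: (@eq_from_nth _ None) => [|k]; rewrite size_word // => ltkn.
rewrite nth_word; case wk: (nth None w k) => [i|].
  by apply/eqP; rewrite tile_atE /place /= ffunE fE (index_tile uniq_w wk).
rewrite /tile_at; case: pickP => // i; rewrite /place /= ffunE fE => /eqP e.
by rewrite -e nth_index in wk.
Qed.

Lemma tile_at_none c k : tile_at c k = None <-> forall i, place c i <> k.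
Proof.
split=> [e i /eqP|ne]; first by rewrite -tile_atE e.
by case E: tile_at => [i|] //; case: (ne i); apply/eqP; rewrite -tile_atE E.
Qed.

Lemma slide_ofP c c' i : reflect
  [/\ forall j, j != i -> place c' j = place c j, tile_at c (place c' i) = None,
      strip_adj (place c i) (place c' i) &
      exists m, [/\ m < n, tile_at c m = None, strip_adj (place c i) m
                         & strip_adj (place c' i) m]]
  (slide_of i c c').
Proof.
apply: (iffP and4P); rewrite holeE hex_adjE => -[cc' /eqP free nearc third].
  split=> // [j ji|].
    by rewrite /place; move/forallP/(_ j)/implyP/(_ ji)/eqP: cc' => ->.
  case/existsP: third => r /and3P[]; rewrite holeE !hex_adjE => /eqP ? ? ?.
  by exists (idx r); rewrite idx_lt.
split=> //; last first.
  case: third => m [/idx_onto[r <-]] ? ? ?.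
  apply/existsP; exists r; rewrite holeE !hex_adjE.
  by apply/and3P; split=> //; apply/eqP.
by apply/forallP=> j; apply/implyP=> /cc'/idx_inj ->.
Qed.

Lemma strip_adj_sym k l : strip_adj k l = strip_adj l k.
Proof. rewrite /strip_adj; lia. Qed.

Lemma slide_sym : symmetric (@slide B h).
Proof.
suff slideW c c' : slide c c' -> slide c' c.
  by move=> c c'; apply/idP/idP; apply: slideW.
case/existsP=> i /slide_ofP[cc' /tile_at_none free nearc +].
case=> m [ltmn /tile_at_none mfree n1 n2].
apply/existsP; exists i; apply/slide_ofP; split.
- by move=> j /cc'.
- apply/tile_at_none => j; have [->|ji] := eqVneq j i.
    by move=> e; move: nearc; rewrite e /strip_adj eqxx.
  by rewrite cc' // => /place_inj/eqP; rewrite (negbTE ji).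
- by rewrite strip_adj_sym.
exists m; split=> //; apply/tile_at_none => j; have [->|ji] := eqVneq j i.
  by move=> e; move: n2; rewrite e /strip_adj eqxx.
by rewrite cc'.
Qed.

Lemma puzE : @puz B h =2 @slide B h.
Proof. by move=> c c'; rewrite /puz /= slide_sym orbb. Qed.

(** The hole [m] that assists the move lies just before or just after the two
    places that exchange their contents. *)
Lemma slide_hop c c' u v i m :
    word c = u ++ [:: Some i, None & v] -> word c' = u ++ [:: None, Some i & v] ->
    m < n -> tile_at c m = None -> m.+1 = size u \/ m = (size u).+2 ->
  slide c c'.
Proof.
move=> wc wc' ltmn mfree mu; apply/existsP; exists i; apply/slide_ofP.
have atc : place c i = size u.
  by apply/eqP; rewrite -tile_atE -nth_word wc nth_cat ltnn subnn.
have atc' : place c' i = (size u).+1.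
  by apply/eqP; rewrite -tile_atE -nth_word wc' nth_cat ltnNge leqnSn subSnn.
have free : tile_at c (size u).+1 = None.
  by rewrite -nth_word wc nth_cat ltnNge leqnSn subSnn.
rewrite atc atc'; split=> //.
- move=> j ji; apply/eqP; rewrite -tile_atE -nth_word wc'.
  have ne0 : place c j != size u by rewrite -atc (inj_eq (@place_inj c)).
  have ne1 : place c j != (size u).+1.
    by apply/eqP; apply: (proj1 (tile_at_none _ _) free).
  have /eqP : nth None (word c) (place c j) = Some j.
    by apply/eqP; rewrite nth_word tile_atE.
  rewrite wc !nth_cat; case: ltnP => // leu.
  have -> // : place c j - size u = (place c j - size u).-2.+2 by lia.
- by rewrite /strip_adj; lia.
by exists m; rewrite ltmn mfree; split=> //; rewrite /strip_adj; lia.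
Qed.

(** The prefix [u] lets the induction enter a word through [reach_cons].
    Transitivity is sound because moves keep the size and the labels of a word,
    so that the intermediate word is again that of a configuration. *)
Lemma reach_connect w w' : reach w w' -> forall u c c',
  word c = u ++ w -> word c' = u ++ w' -> connect (@puz B h) c c'.
Proof.
have puz_sym : connect_sym (@puz B h).
  by apply: sym_connect_sym => c c'; rewrite !puzE slide_sym.
elim=> {w w'} [i v|i v|x w w' _ IH|w|w w' _ IH|w w' w'' r IH r' IH'].
all: move=> u c c' wc wc'.
- apply: connect1; rewrite puzE.
  have lt : (size u).+2 < n by move: (size_word c); rewrite wc size_cat /=; lia.
  apply: (slide_hop wc wc' lt); last by right.
  by rewrite -nth_word wc nth_cat ltnNge -addn2 leq_addr addKn.
- apply: connect1; rewrite puzE.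
  have lt : size u < n by move: (size_word c); rewrite wc size_cat /=; lia.
  rewrite -cat_rcons in wc; rewrite -cat_rcons in wc'.
  apply: (slide_hop wc wc' lt); last by left; rewrite size_rcons.
  by rewrite -nth_word wc cat_rcons nth_cat ltnn subnn.
- by apply: (IH (rcons u x)); rewrite cat_rcons.
- by rewrite (word_inj (etrans wc (esym wc'))) connect0.
- by rewrite puz_sym; apply: IH wc' wc.
have ru := reach_cat u r.
have [||| c1 wc1] := @word_onto (u ++ w').
- by rewrite -(reach_size ru) -wc size_word.
- by rewrite -(reach_labels ru) -wc order_uniq.
- by rewrite -(reach_labels ru) -wc; apply/eqP/order_size.
exact: connect_trans (IH _ _ _ wc wc1) (IH' _ _ _ wc1 wc').
Qed.

(** The three indices involved in a slide are consecutive, so any other tile has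
    both the old and the new place of the sliding tile on the same side. *)
Lemma slide_order c c' : slide c c' -> tile_order c = tile_order c'.
Proof.
case/existsP=> i /slide_ofP[cc' /tile_at_none free nearc +].
case=> m [_ /tile_at_none mfree n1 n2].
have same : (fun j k => place c j < place c k)
    =2 (fun j k => place c' j < place c' k).
  have mv j : j != i -> (place c j < place c i) = (place c j < place c' i)
      /\ (place c i < place c j) = (place c' i < place c j).
    move=> ji; have := free j; have := mfree j; move: ji.
    rewrite -(inj_eq (@place_inj c)) => /eqP; move: nearc n1 n2.
    by rewrite /strip_adj; lia.
  move=> j k; have [->|ji] := eqVneq j i; have [->|ki] := eqVneq k i.
  - by rewrite !ltnn.
  - by rewrite (cc' _ ki); apply: (mv _ ki).2.
  - by rewrite (cc' _ ji); apply: (mv _ ji).1.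
  - by rewrite !cc'.
apply: (irr_sorted_eq (leT := fun j k => place c j < place c k)).
- by move=> j k l; apply: ltn_trans.
- by move=> j; apply: ltnn.
- exact: sorted_order.
- by rewrite (eq_sorted same); apply: sorted_order.
by move=> j; rewrite !mem_order.
Qed.

Lemma connect_order c c' :
  connect (@puz B h) c c' -> tile_order c = tile_order c'.
Proof.
case/connectP=> p; elim: p c => [c _ -> //|c1 p IH c /= /andP[cc1 pth] e].
by rewrite -(IH _ pth e); apply: slide_order; rewrite -puzE.
Qed.

(** Of the two holes involved in a slide, either the indices are consecutive, or
    they differ by two and the sliding tile stands between them. *)
Lemma loose_word c : ~~ isolated c -> loose (word c).
Proof.
rewrite negbK => /existsP[c' /existsP[i /slide_ofP[_]]].
have : place c' i < n by apply: idx_lt.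
move: (place c' i) => q ltqn qfree nearc [m [ltmn mfree n1 n2]].
(* Either the target of the slide or the assisting hole may come first. *)
have wlog_lt k l : k < l < n -> tile_at c k = None -> tile_at c l = None ->
    strip_adj (place c i) k -> strip_adj (place c i) l -> strip_adj k l ->
  loose (word c).
  case/andP=> ltkl ltln kfree lfree nik nil nkl.
  have kS : k.+1 < size (word c) by rewrite size_word; lia.
  exists (take k (word c)).
  have wk : word c =
      take k (word c) ++ [:: None, tile_at c k.+1 & drop k.+2 (word c)].
    rewrite -{1}(cat_take_drop k (word c)) (drop_nth None); last by lia.
    by rewrite !nth_word kfree (drop_nth None) ?nth_word.
  have [l1|l2] : l = k.+1 \/ l = k.+2 by move: nkl; rewrite /strip_adj; lia.
    by exists (drop k.+2 (word c)); left; rewrite {1}wk -l1 lfree.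
  exists (drop k.+3 (word c)); right; exists i; rewrite {1}wk.
  have /eqP -> : tile_at c k.+1 == Some i.
    rewrite tile_atE; move: nik nil; rewrite /strip_adj l2; lia.
  by rewrite (drop_nth None (n := k.+2)) ?nth_word -?l2 ?lfree ?size_word.
have [ltqm|ltmq|e] := ltngtP q m.
- by apply: (wlog_lt q m); rewrite // ltqm.
- by apply: (wlog_lt m q); rewrite // ?ltmq // strip_adj_sym.
- by move: n2; rewrite /strip_adj e eqxx.
Qed.

(** The number of leading holes in the sorted word is forced by its size, so the
    label order determines this word. *)
Lemma order_connect c c' : ~~ isolated c -> ~~ isolated c' ->
  tile_order c = tile_order c' -> connect (@puz B h) c c'.
Proof.
move=> /loose_word/reach_sorted[a r] /loose_word/reach_sorted[b r'] e.
rewrite -!/(tile_order _) in r r'; rewrite -e in r'.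
have ab : a = b.
  have := reach_size r; have := reach_size r'.
  rewrite !size_word !size_cat !size_nseq; lia.
rewrite -ab in r'.
exact: (reach_connect (reach_trans r (reach_sym r')) (u := [::]) erefl erefl).
Qed.

Lemma order_onto (l : seq I) : uniq l -> size l = n - h ->
  exists2 c, ~~ isolated c & tile_order c = l.
Proof.
move=> uniq_l size_l; case: l uniq_l size_l => [|i l] uniq_l size_l.
  by move: hh; move: size_l => /=; lia.
have h_gt0 : 0 < h by move: hh; lia.
(* All holes come first; the first tile can step back into the last hole, with
   the help of the hole before it. *)
have [c wc] : exists c, word c = nseq h.-1 None ++ [:: None, Some i & map Some l].
  have e : pmap id (nseq h.-1 None ++ [:: None, Some i & map Some l]) = i :: l.
    by rewrite pmap_cat /= map_pK //; elim: h.-1.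
  apply: word_onto; rewrite ?e // size_cat size_nseq /= size_map.
  by move: size_l hh => /=; lia.
have [c' wc'] : exists c, word c = nseq h.-1 None ++ [:: Some i, None & map Some l].
  have e : pmap id (nseq h.-1 None ++ [:: Some i, None & map Some l]) = i :: l.
    by rewrite pmap_cat /= map_pK //; elim: h.-1.
  apply: word_onto; rewrite ?e // size_cat size_nseq /= size_map.
  by move: size_l hh => /=; lia.
exists c; last by rewrite /tile_order wc pmap_cat /= map_pK //; elim: h.-1.
rewrite negbK; apply/existsP; exists c'; rewrite slide_sym.
apply: (slide_hop (m := h.-2) wc' wc); first by move: hh; lia.
  rewrite -nth_word wc' nth_cat size_nseq nth_nseq.
  by case: ifP; [case: ifP | move: hh; lia].
by left; rewrite size_nseq; move: hh; lia.
Qed.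

Definition tile_order_tuple c : (n - h).-tuple I := Tuple (order_size c).

(** Both the component and the label order are functions of a configuration, and
    they have the same fibres on configurations that are not isolated: there
    are as many such components as orders. *)
Lemma card_components :
  #|[set C in components (@puz B h) | [exists c in C, ~~ isolated c]]|
    = (n - h)`!.
Proof.
have puz_sym : connect_sym (@puz B h).
  by apply: sym_connect_sym => c c'; rewrite !puzE slide_sym.
pose cls c := [set c' in [set: config B h] | connect (@puz B h) c c'].
have clsP c c' : (cls c == cls c') = connect (@puz B h) c c'.
  apply/eqP/idP => [e|cc'].
    have : c' \in cls c' by rewrite !inE connect0.
    by rewrite -e !inE.
  by apply/setP=> d; rewrite !inE (same_connect puz_sym cc').
have -> : [set C in components (@puz B h) | [exists c in C, ~~ isolated c]]
    = cls @: [set c | ~~ isolated c].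
  apply/setP=> C; rewrite inE; apply/andP/imsetP.
    case=> /imsetP[c0 _ ->] /existsP[c /andP[c0c nic]].
    exists c; first by rewrite inE.
    by apply/eqP; rewrite -/(cls _) clsP; move: c0c; rewrite !inE.
  case=> c; rewrite inE => nic ->; split; first exact: imset_f.
  by apply/existsP; exists c; rewrite nic !inE connect0.
rewrite (eq_card_imset (g := tile_order_tuple)); last first.
  move=> c c'; rewrite !inE clsP => nic nic'.
  apply/idP/eqP => [/connect_order e | [] ]; first exact: val_inj.
  exact: order_connect.
transitivity (#|[set u : (n - h).-tuple I | all predT u & uniq u]|); last first.
  by rewrite card_uniq_tuples card_ord ffactnn.
congr #|pred_of_set _|; apply/setP=> u; rewrite !inE all_predT /=.
apply/imsetP/idP => [[c _ ->]|uniq_u]; first exact: order_uniq.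
have [c nic e] := order_onto uniq_u (size_tuple u).
by exists c; [rewrite inE | apply: val_inj].
Qed.
End Strip.

(** * The two-column parallelogram as a strip *)

Section Parallelogram.
Local Open Scope ring_scope.

Lemma parallelogramP m1 m2 (p : hexagon) :
  reflect (exists i j : nat, [/\ (i < m1)%N, (j < m2)%N & p = (i%:Z, j%:Z)])
    (p \in parallelogram m1 m2).
Proof.
apply: (iffP (imfset2P _ _ _ _ _)) => [[i /= ii [j jj ->]]|[i [j [ii jj ->]]]].
  by exists i, j; move: ii jj; rewrite /= !mem_iota.
by exists i; rewrite /= ?mem_iota //; exists j; rewrite //= mem_iota.
Qed.

Lemma card_parallelogram m1 m2 : #|` parallelogram m1 m2| = (m1 * m2)%N.
Proof.
pose s := [seq (i%:Z, j%:Z) | i <- iota 0 m1, j <- iota 0 m2].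
have -> : parallelogram m1 m2 = [fset p in s]%fset.
  apply/fsetP=> p; rewrite inE /=; apply/imfset2P/allpairsP.
    by case=> i ii [j jj ->]; exists (i, j).
  by case=> [[i j] [/= ii jj ->]]; exists i => //; exists j.
rewrite card_fseq undup_id ?size_allpairs ?size_iota //.
by apply: allpairs_uniq; rewrite ?iota_uniq // => -[i j] [k l] _ _ [-> ->].
Qed.

(** Row [j] holds the indices 2 j, in column 1, and 2 j + 1, in column 0: as
    (1, 1) is an adjacency, hexagon (0, j) touches (1, j + 1). *)
Definition strip_index (p : hexagon) : nat := `|(2 * p.2 + 1 - p.1)%R|%N.

Lemma strip_hex_adj m (p q : hexagon) :
  p \in parallelogram 2 m -> q \in parallelogram 2 m ->
  hex_adj p q = strip_adj (strip_index p) (strip_index q).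
Proof.
case/parallelogramP=> i [j [ii _ ->]] /parallelogramP[k [l [kk _ ->]]].
rewrite /hex_adj /strip_adj /strip_index !inE !xpair_eqE /=.
lia.
Qed.

Lemma strip_index_inj m : {in parallelogram 2 m &, injective strip_index}.
Proof.
move=> _ _ /parallelogramP[i [j [ii _ ->]]] /parallelogramP[k [l [kk _ ->]]].
by rewrite /strip_index /= => e; congr (_%:Z, _%:Z); lia.
Qed.

Lemma strip_index_lt m p : p \in parallelogram 2 m -> (strip_index p < 2 * m)%N.
Proof.
by case/parallelogramP=> i [j [ii jj ->]]; rewrite /strip_index /=; lia.
Qed.

End Parallelogram.

Theorem theorem1p1 (m1 m2 h : nat) (hm1 : m1 = 2) (hm2 : 2 <= m2)
    (hh : 2 <= h < m1 * m2) :
  #|[set C in components (@puz (parallelogram m1 m2) h)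
       | [exists c in C, ~~ isolated c]]| = (m1 * m2 - h)`!.
Proof.
subst m1; rewrite -[2 * m2]card_parallelogram.
apply: (card_components (idx := fun p => strip_index (val p))).
- by move=> p q e; apply/val_inj/(strip_index_inj (valP p) (valP q) e).
- by move=> p; rewrite card_parallelogram; apply: strip_index_lt (valP p).
- by move=> p q; apply: strip_hex_adj (valP p) (valP q).
- by rewrite card_parallelogram.
Qed.
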